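(* Let $K$ be a compact (Hausdorff) space. Then $K$ is monotonically retractable if and only if $K$ is Corson.
   Context: All topological spaces are assumed to be Tychonoff (so compact spaces are Hausdorff). A retraction on $X$ is a continuous map $r:X\to X$ with $r\circ r=r$. Monotonically retractable: a space $X$ is monotonically retractable if one can assign to every countable set $A\subset X$ a retraction $r_A:X\to X$ and a countable family $\mathcal{N}(A)$ of subsets of $X$ such that: $A\subset r_A[X]$; the assignment $A\mapsto\mathcal{N}(A)$ is $\omega$-monotone, i.e. $A\subset B$ (countable) implies $\mathcal{N}(A)\subset\mathcal{N}(B)$, and $\mathcal{N}(\bigcup_{n}A_n)=\bigcup_{n}\mathcal{N}(A_n)$ for every increasing sequence $(A_n)$ of countable subsets of $X$; and $\mathcal{N}(A)$ is a network of $r_A$, i.e. $r_A^{-1}(U)$ is the union of a subfamily of $\mathcal{N}(A)$ for every open $U\subset X$. A compact space is Corson if it is homeomorphic to a subspace of $\{x\in\mathbb{R}^{I}: \{i\in I: x(i)\neq 0\}\text{ is countable}\}$ (with the product topology of $\mathbb{R}^I$) for some set $I$. *)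

(* Defs.v *)
From HB Require Import structures.
From mathcomp Require Import all_boot all_order all_algebra.
From mathcomp Require Import all_classical all_reals topology num_topology.
From mathcomp Require Import function_spaces subtype_topology separation_axioms.

Set Implicit Arguments.
Unset Strict Implicit.
Unset Printing Implicit Defensive.

Import Order.TTheory GRing.Theory Num.Theory.
Import numFieldTopology.Exports.

Local Open Scope classical_set_scope.
Local Open Scope ring_scope.

Definition retraction (X : topologicalType) (r : X -> X) : Prop :=
  continuous r /\ idempotent_fun r.

(* An assignment on the countable subsets of [X] is encoded as a total function
   whose values at uncountable sets are left unconstrained. *)
Definition omega_monotone (X Y : Type) (N : set X -> set Y) : Prop :=
  (forall A B : set X, countable A -> countable B ->
     A `<=` B -> N A `<=` N B) /\
  (forall A : nat -> set X, (forall n, countable (A n)) ->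
     (forall m n, (m <= n)%N -> A m `<=` A n) ->
     N (\bigcup_n A n) = \bigcup_n N (A n)).

Definition network_of_map (X Y : topologicalType) (r : X -> Y)
    (F : set (set X)) : Prop :=
  forall U : set Y, open U ->
    exists2 G : set (set X), G `<=` F & r @^-1` U = \bigcup_(P in G) P.

Definition monotonically_retractable (X : topologicalType) : Prop :=
  exists (r : set X -> X -> X) (N : set X -> set (set X)),
    omega_monotone N /\
    forall A : set X, countable A ->
      [/\ retraction (r A),
          A `<=` range (r A),
          countable (N A) &
          network_of_map (r A) (N A)].

Definition homeomorphic (X Y : topologicalType) : Prop :=
  exists (f : X -> Y) (g : Y -> X),
    [/\ continuous f, continuous g, cancel f g & cancel g f].

Definition Sigma_product (R : realType) (I : Type) : set {ptws I -> R} :=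
  [set x | countable [set i | x i != 0]].
Arguments Sigma_product : clear implicits.

(* [S], coerced to a type, carries the subspace topology induced by the
   product topology of [{ptws I -> R}]. *)
Definition corson (R : realType) (K : topologicalType) : Prop :=
  exists (I : Type) (S : set {ptws I -> R}),
    S `<=` Sigma_product R I /\ homeomorphic K S.
Arguments corson : clear implicits.

(* Main.v *)
Require Import Defs.
From HB Require Import structures.
From mathcomp Require Import all_boot all_order all_algebra.
From mathcomp Require Import all_classical all_reals topology separation_axioms.
From mathcomp Require Import num_topology function_spaces subtype_topology.
From mathcomp Require Import normedtype urysohn.

(** Both properties are compared with a third one: the existence of a Sigma
    family on [K], a point-separating family [E] of continuous real functions
    only countably many of which are nonzero at any given point.  A Corson
    space carries one, its coordinates; conversely, evaluation at the members
    of [E] maps the compact space [K] homeomorphically into a Sigma-product.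

    From a Sigma family to retractions.  Let [J] be a subset of [E].  The
    retraction attached to [J] should send [x] to the point having the same
    values as [x] on [J] and the value 0 on the rest of [E].  By compactness
    this point exists as soon as every nonempty box cut out by finitely many
    members of [J], with rational bounds, contains a point whose support lies
    in [J].  Selecting one point per box makes this a closure condition that
    is finitary and adds countably many functions at a time.  Hence the
    supports of the points of a countable set [A] generate a countable such
    [J], which depends on [A] in an omega-monotone way, and the boxes over
    [J] are a network for the retraction.

    From retractions to a Sigma family.  Omega-monotonicity makes [N]
    finitary, so that it is determined by its values at finite sets.  Call
    [A] good if it contains selected points of all nonempty intersections of
    two members of the [N s], for [s] a finite subset of [A].  If [A] is
    countable and good then [r A x] is the limit of the traces on [A] of the
    members of [N A] that contain [x] ([retraction_limit]).  So [r A] is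
    determined by [N A], and the inclusion of [N A] in [N B] yields
    [r A (r B x) = r A x] for good [B] containing [A] ([retraction_comp]).  A
    similar closure argument shows that [K] is countably tight.  Tightness
    allows the retractions of the countable good subsets of an arbitrary good
    set [A] to be glued into one retraction [rho A] of [K] onto the closure of
    [A], and again [rho A (rho B x) = rho A x] ([rho_comp]).

    Now well-order [K], and consider the increasing chain of good sets
    generated by the initial segments.  If [E b] is a Sigma family for the
    stage that ends with [b], a Sigma family for the union consists of the
    functions [e \o rho (stage (upto b)) - e \o rho (stage (below b))], for
    [e] in [E b], and of a countable family for the stage of the empty segment.
    Indeed two distinct points are first told apart at some stage, hence by one
    of these functions; and a point moves at only countably many stages
    because, by tightness, either it stops moving before the end or countably
    many stages are cofinal, so that induction applies ([countable_jumps]).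
    The induction that feeds this step needs no cardinal arithmetic
    ([wo_chain_induction]). *)

Set Implicit Arguments.
Unset Strict Implicit.
Unset Printing Implicit Defensive.

Import Order.TTheory GRing.Theory Num.Theory.
Import numFieldTopology.Exports.

Local Open Scope classical_set_scope.
Local Open Scope ring_scope.

(** * Countable sets and selections *)

Lemma subset_countable (T : Type) (A B : set T) :
  A `<=` B -> countable B -> countable A.
Proof. by move=> /subset_card_le; exact: sub_countable. Qed.

Lemma image_countable (T U : Type) (f : T -> U) (A : set T) :
  countable A -> countable (f @` A).
Proof. exact/sub_countable/card_image_le. Qed.

(** A choice function on the nonempty subsets, with values in small subsets
    rather than in points so that an empty [T] needs no default element. *)
Lemma countable_selection (T : Type) :
  exists sel : set T -> set T, forall P : set T,
    [/\ countable (sel P), sel P `<=` P & P !=set0 -> sel P !=set0].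
Proof.
suff /choice[sel selP] : forall P : set T, exists Q : set T,
    [/\ countable Q, Q `<=` P & P !=set0 -> Q !=set0] by exists sel.
move=> P; have [[x Px]|P0] := pselect (P !=set0).
  by exists [set x]; split=> [||_]; [exact: countable1|move=> _ ->|exists x].
by exists set0; split.
Qed.

Lemma countableU (T : Type) (A B : set T) :
  countable A -> countable B -> countable (A `|` B).
Proof.
by move=> cA cB; rewrite -bigcup2E; apply: bigcup_countable => // -[|[|k]] _.
Qed.

(** * Closure under finitary operations *)

Section FinitaryHull.
Context {T : choiceType}.
Implicit Types (A B : set T) (s : seq T) (Phi : seq T -> set T).

Lemma seq_sub_directed (I : Type) (D : set I) (F : I -> set T) s :
  D !=set0 ->
  (forall i j, D i -> D j ->
     exists2 k, D k & F i `<=` F k /\ F j `<=` F k) ->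
  [set` s] `<=` \bigcup_(i in D) F i ->
  exists2 i, D i & [set` s] `<=` F i.
Proof.
move=> [i0 Di0] dirF; elim: s => [|x s IHs] sF; first by exists i0.
have [i Di xFi] : (\bigcup_(i in D) F i) x by apply: sF; rewrite /= mem_head.
have [|j Dj sFj] := IHs.
  by move=> y ys; apply: sF; rewrite /= inE [X in _ || X]ys orbT.
have [k Dk [ik jk]] := dirF _ _ Di Dj.
exists k => // y /=; rewrite inE => /orP[/eqP ->|ys]; first exact: ik.
exact/jk/sFj.
Qed.

Lemma countable_seq_sub A :
  countable A -> countable [set s : seq T | [set` s] `<=` A].
Proof.
move=> cA; pose L n := [set s : seq T | [set` s] `<=` A /\ size s = n].
have cL n : countable (L n).
  elim: n => [|n IHn].
    by apply: subset_countable (countable1 [::]) => s [_ /size0nil ->].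
  have := image_countable (fun u => u.1 :: u.2) (countableX cA IHn).
  apply: subset_countable => -[|x s] [xsA] // [sn]; exists (x, s) => //=.
  split; first by apply: xsA; rewrite /= mem_head.
  by split=> // y ys; apply: xsA; rewrite /= inE [X in _ || X]ys orbT.
have := bigcup_countable (countableP [set: nat]) (fun n _ => cL n).
apply: subset_countable => s sA.
by exists (size s).
Qed.

Definition closed_under Phi A := forall s, [set` s] `<=` A -> Phi s `<=` A.

Definition hull Phi A : set T :=
  [set x | forall B, closed_under Phi B -> A `<=` B -> B x].

Lemma sub_hull Phi A : A `<=` hull Phi A.
Proof. by move=> x Ax B _; apply. Qed.

Lemma hull_min Phi A B : closed_under Phi B -> A `<=` B -> hull Phi A `<=` B.
Proof. by move=> cB AB x; apply. Qed.

Lemma hull_closed Phi A : closed_under Phi (hull Phi A).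
Proof.
move=> s sA x sx B cB AB; apply: (cB s) sx; apply: subset_trans sA _.
exact: hull_min.
Qed.

Lemma hull_mono Phi A B : A `<=` B -> hull Phi A `<=` hull Phi B.
Proof.
move=> AB; apply: hull_min (@hull_closed _ _) _.
exact: subset_trans AB (@sub_hull _ _).
Qed.

Lemma closed_underI Phi A B :
  closed_under Phi A -> closed_under Phi B -> closed_under Phi (A `&` B).
Proof.
move=> cA cB s; rewrite !subsetI => -[sA sB].
by split; [exact: cA|exact: cB].
Qed.

(** The hulls of the finite subsets of [A] form a directed family. *)
Lemma seq_sub_hull Phi A s :
  (forall x, x \in s ->
     exists2 t : seq T, [set` t] `<=` A & hull Phi [set` t] x) ->
  exists2 t : seq T, [set` t] `<=` A & [set` s] `<=` hull Phi [set` t].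
Proof.
move=> sA; apply: (@seq_sub_directed _ [set t : seq T | [set` t] `<=` A]
  (fun t : seq T => hull Phi [set` t]) s).
- by exists [::].
- move=> t u tA uA; exists (t ++ u).
    by move=> z /=; rewrite mem_cat => /orP[/tA|/uA].
  by split; apply: hull_mono => z /=; rewrite mem_cat => ->; rewrite ?orbT.
- by move=> z /sA[t tA tz]; exists t.
Qed.

Lemma hull_finitary Phi A x :
  hull Phi A x -> exists2 s : seq T, [set` s] `<=` A & hull Phi [set` s] x.
Proof.
pose B : set T :=
  [set y | exists2 s : seq T, [set` s] `<=` A & hull Phi [set` s] y].
apply: (hull_min (B := B)) x => [s /seq_sub_hull[t tA st] y sy|y Ay].
  by exists t => //; apply: (hull_closed st) sy.
exists [:: y]; first by move=> z /=; rewrite inE => /eqP ->.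
by apply: sub_hull; rewrite /= mem_head.
Qed.

Lemma hull_seq_finitary Phi A s :
  [set` s] `<=` hull Phi A ->
  exists2 t : seq T, [set` t] `<=` A & [set` s] `<=` hull Phi [set` t].
Proof. by move=> sA; apply: seq_sub_hull => x /sA/hull_finitary. Qed.

(** With [hull_mono], this is the omega-monotonicity of the assignments built
    from hulls. *)
Lemma hull_bigcup Phi (A : nat -> set T) :
  (forall m n, (m <= n)%N -> A m `<=` A n) ->
  hull Phi (\bigcup_n A n) = \bigcup_n hull Phi (A n).
Proof.
move=> mA; apply/seteqP; split; last first.
  by move=> x [n _]; apply: hull_mono => y Ay; exists n.
move=> x /hull_finitary[s sA sx].
have [||n _ sn] := seq_sub_directed _ _ sA; first by exists 0%N.
- move=> i j _ _; exists (maxn i j) => //.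
  by split; apply: mA; rewrite ?leq_maxl ?leq_maxr.
- by exists n => //; apply: hull_mono sx.
Qed.

Lemma countable_hull Phi A :
  (forall s, countable (Phi s)) -> countable A -> countable (hull Phi A).
Proof.
move=> cPhi cA.
pose step B := B `|` \bigcup_(s in [set s : seq T | [set` s] `<=` B]) Phi s.
pose S n := iter n step A.
have mS m n : (m <= n)%N -> S m `<=` S n.
  move=> /subnK <-; elim: (n - m)%N => [//|k IHk] x /IHk; by left.
have cS n : countable (S n).
  elim: n => [//|n IHn].
  rewrite [S _]/= /step; apply: countableU => //.
  by apply: bigcup_countable; [exact: countable_seq_sub|move=> s _].
have := bigcup_countable (countableP [set: nat]) (fun n _ => cS n).
apply: subset_countable; apply: hull_min; last first.
  by move=> x Ax; exists 0%N.
move=> s sS x sx.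
have [||n _ sn] := seq_sub_directed _ _ sS; first by exists 0%N.
- move=> i j _ _; exists (maxn i j) => //.
  by split; apply: mS; rewrite ?leq_maxl ?leq_maxr.
- by exists n.+1 => //=; right; exists s.
Qed.

Lemma countable_sub_hull Phi A B :
  countable B -> B `<=` hull Phi A ->
  exists C, [/\ countable C, C `<=` A & B `<=` hull Phi C].
Proof.
move=> cB BA.
have /choice[t tP] : forall b, exists s : seq T,
    B b -> [set` s] `<=` A /\ hull Phi [set` s] b.
  move=> b; have [/BA/hull_finitary[s sA sb]|nB] := pselect (B b).
    by exists s.
  by exists [::].
exists (\bigcup_(b in B) [set` t b]); split.
- apply: bigcup_countable => // b _; apply: finite_set_countable.
  exact: finite_seq.
- by move=> x [b Bb]; have [+ _] := tP b Bb; apply.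
- move=> b Bb; have [_] := tP b Bb; apply: hull_mono => x tx; by exists b.
Qed.

End FinitaryHull.

(** * Induction along a well-order *)

Lemma exists_well_order (T : choiceType) : exists le : rel T,
  [/\ total le, antisymmetric le, transitive le &
      forall Q : T -> Prop,
        (forall b, (forall c, le c b -> c != b -> Q c) -> Q b) ->
        forall b, Q b].
Proof.
have [le wo] := wochoice.well_ordering_principle T.
have ch : wochoice.wo_chain le (@predT T) by move=> A _; exact: wo.
have tot : total le by move=> x y; exact: (wochoice.wo_chainW ch).
have anti : antisymmetric le.
  by move=> x y; exact: (wochoice.wo_chain_antisymmetric ch).
exists le; split => //.
- move=> y x z xy yz.
  have [|m [[+ mmin] _]] := wo [pred t | t \in [:: x; y; z]].
    by exists x; rewrite !inE eqxx.
  rewrite !inE => /or3P[]/eqP mE; rewrite {}mE in mmin.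
  + by apply: mmin; rewrite !inE eqxx !orbT.
  + have yx : le y x by apply: mmin; rewrite !inE eqxx.
    by rewrite (anti x y) // xy yx.
  + have zy : le z y by apply: mmin; rewrite !inE eqxx !orbT.
    by rewrite (anti z y) // zy yz.
- move=> Q step b; apply: contrapT => nQb.
  have [|m [[/asboolP nQm mmin] _]] := wo [pred t | `[< ~ Q t >]].
    by exists b; apply/asboolP.
  apply: nQm; apply: step => c cm cNm; apply: contrapT => nQc.
  move/eqP: cNm; apply; apply: anti; rewrite cm /=; apply: mmin.
  exact/asboolP.
Qed.

Lemma infinite_set_injection (T : Type) (A : set T) :
  infinite_set A -> exists2 u : nat -> T, injective u & forall n, A (u n).
Proof.
move=> /infiniteP/card_leP[u].
exists (fun n => val (u (SigSub (mem_set (I : setT n))))) => [m n|n].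
  2: exact: set_valP.
by move=> /val_inj/(@inj _ _ _ u); rewrite !inE => /(_ I I)/(congr1 val).
Qed.

Section WellOrderedInduction.
Context {T : choiceType} (le : rel T).
Hypotheses (le_total : total le) (le_anti : antisymmetric le)
  (le_trans : transitive le).
Hypothesis le_ind : forall Q : T -> Prop,
  (forall b, (forall c, le c b -> c != b -> Q c) -> Q b) -> forall b, Q b.

Definition below b : set T := [set c | le c b /\ c != b].
Definition upto b : set T := [set c | le c b].
Definition initial (D : set T) := forall b c, D b -> le c b -> D c.

Lemma total_refl b : le b b.
Proof. by have := le_total b b; rewrite orbb. Qed.

Lemma initial_below b : initial (below b).
Proof.
move=> c d [cb cNb] dc; split; first exact: le_trans cb.
apply: contra_neq cNb => dE; apply: le_anti; rewrite cb /=.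
by rewrite -dE.
Qed.

Lemma uptoE b : upto b = below b `|` [set b].
Proof.
apply/seteqP; split => [c cb|c [[]//|->]].
  by have [->|cNb] := eqVneq c b; [right|left].
exact: total_refl.
Qed.

(** Hilbert's hotel: a sequence in [below b], shifted by one place, makes room
    for [b]. *)
Lemma uncountable_upto_reindex (Y : Type) (f : T -> Y) b :
  ~ countable (upto b) -> exists g : T -> Y, f @` upto b = g @` below b.
Proof.
move=> nc.
have inf : infinite_set (below b).
  move=> fin; apply: nc; rewrite uptoE; apply: finite_set_countable.
  by rewrite finite_setU; split => //; exact: finite_set1.
have [u u_inj ub] := infinite_set_injection inf.
have /choice[h hP] : forall x, exists y,
    [/\ x = u 0%N -> y = b, forall n, x = u n.+1 -> y = u n &
        (forall n, x <> u n) -> y = x].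
  move=> x; have [[[|n] ->]|xNu] := pselect (exists n, x = u n).
  - by exists b; split=> [//|n /u_inj//|/(_ 0%N)].
  - by exists (u n); split=> [/u_inj//|m /u_inj[->]//|/(_ n.+1)].
  - exists x; split=> [x0|n xn|//]; first by case: xNu; exists 0%N.
    by case: xNu; exists n.+1.
exists (f \o h); rewrite -image_comp; congr (f @` _).
apply/seteqP; split=> [c cb|_ [x xb <-]]; last first.
  have [h0 hS hN] := hP x.
  have [[[|n] xu]|xNu] := pselect (exists n, x = u n).
  - by rewrite h0 //; exact: total_refl.
  - by rewrite (hS n) //; have [] := ub n.
  - by rewrite hN => [|n xn]; [case: xb|apply: xNu; exists n].
have [->|cNb] := eqVneq c b.
  by exists (u 0%N) => //; have [-> //] := hP (u 0%N).
have [[n ->]|cNu] := pselect (exists n, c = u n).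
  by exists (u n.+1) => //; have [_ hS _] := hP (u n.+1); exact: hS.
exists c => //; have [_ _ -> // n cn] := hP c; by apply: cNu; exists n.
Qed.

(** A property of sets passes from countable sets to the whole type once it
    is inherited by unions of well-ordered chains.  The usual proof is an
    induction on cardinality, which ensures that the links of a chain are
    smaller than its union.  Quantifying over the map [f] replaces it: the
    induction is on [b], for all images of [upto b] at once.  Since [upto b]
    can be reindexed by [below b] when it is uncountable, its image is the
    union of a chain of images of shorter segments. *)
Lemma wo_chain_induction (P : set T -> Prop) :
  (forall A, countable A -> P A) ->
  (forall (D : set T) (f : T -> T), initial D ->
     (forall b, D b -> P (f @` upto b)) -> P (f @` D)) ->
  P [set: T].
Proof.
move=> Pc Pchain.
have Pupto : forall b f, P (f @` upto b).
  elim/le_ind => b IH f; have [cb|nc] := pselect (countable (upto b)).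
    exact/Pc/image_countable.
  have [g ->] := uncountable_upto_reindex f nc.
  by apply: Pchain (@initial_below b) _ => c [cb cNb]; exact: IH.
by rewrite -(image_id [set: T]); apply: Pchain.
Qed.

End WellOrderedInduction.

(** * Maps into compact spaces *)

Lemma compact_directed_meet (K : topologicalType) (I : Type) (D : set I)
    (F : I -> set K) :
  compact [set: K] -> D !=set0 ->
  (forall i, D i -> closed (F i)) -> (forall i, D i -> F i !=set0) ->
  (forall i j, D i -> D j -> exists2 k, D k & F k `<=` F i `&` F j) ->
  exists x, forall i, D i -> F i x.
Proof.
move=> cK D0 clF F0 dirF.
have FF : ProperFilter (filter_from D F).
  by apply: filter_from_proper F0; exact: filter_from_filter.
have [|x [_]] := cK _ FF; first exact: filterT.
rewrite clusterE => xF; exists x => i Di; apply: (clF i Di).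
by apply: xF; exists i.
Qed.

(** At a point [x], the values of [f] cluster only at [f x]: the continuous
    maps [e \o f] send every cluster point to [e (f x)], and [E] separates
    points.  In a compact space, a unique cluster point is a limit. *)
Lemma continuous_of_separating (X K Y : topologicalType) (C : set K)
    (E : set (K -> Y)) (f : X -> K) :
  compact [set: K] -> hausdorff_space K -> hausdorff_space Y -> closed C ->
  (forall x, C (f x)) ->
  (forall e, E e -> continuous e /\ continuous (e \o f)) ->
  (forall x y, C x -> C y -> (forall e, E e -> e x = e y) -> x = y) ->
  continuous f.
Proof.
move=> cK hK hY clC Cf Ec sep x.
have sub : cluster (f @ x) `<=` [set f x].
  move=> z zcl; apply: sep => // [|e Ee].
    apply: clC => B zB; apply: zcl (zB).
    by apply: filterS (filterT : nbhs x setT) => y _; exact: Cf.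
  have [ce cef] := Ec e Ee.
  apply: hY => A B eA eB.
  have [|y [eBy eAy]] := zcl (e @^-1` B) _ _ (ce z _ eA).
    exact: (cef x _ eB).
  by exists (e y).
apply: (@compact_cluster_set1 _ (f x) _ setT) => //.
- exact: filterT.
- exact: filterT.
- apply/seteqP; split => // _ ->.
  have [|z [_ zcl]] := cK (f @ x) _; first exact: filterT.
  by rewrite -(sub _ zcl).
Qed.

Lemma ptws_proj_continuous (I : Type) (Y : topologicalType) (i : I) :
  continuous (fun f : {ptws I -> Y} => f i).
Proof.
move=> f A fA.
have /cvg_sup/(_ i) : nbhs (f : {ptws I -> Y}) --> (f : {ptws I -> Y}).
  exact: cvg_id.
apply; exact: (initial_continuous (f := fun g : I -> Y => g i)) fA.
Qed.

Lemma ptws_continuous (X : topologicalType) (I : Type) (Y : topologicalType)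
    (F : X -> {ptws I -> Y}) :
  (forall i, continuous (fun x => F x i)) -> continuous F.
Proof.
move=> cF x; apply/cvg_sup => i.
have := @continuous_comp_initial (I -> Y) X Y (fun f => f i) F (cF i) x.
exact.
Qed.

(** * Sigma families and Corson compacta *)

Section SigmaFamilies.
Context {R : realType} {K : topologicalType}.
Hypotheses (K_compact : compact [set: K]) (K_hausdorff : hausdorff_space K).

Definition supp (E : set (K -> R)) (x : K) : set (K -> R) :=
  [set e | E e /\ e x != 0].

(** Separation is only required on [C], the image of a retraction, whereas the
    supports have to be countable at all points of [K]. *)
Definition sigma_family (C : set K) (E : set (K -> R)) :=
  [/\ forall e, E e -> continuous e,
      forall x, countable (supp E x) &
      forall x y, C x -> C y -> (forall e, E e -> e x = e y) -> x = y].

Lemma corson_sigma_family :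
  corson R K -> exists E, sigma_family [set: K] E.
Proof.
move=> [I [S [S_Sigma [f [g [cf cg fK gK]]]]]].
pose e (i : I) (x : K) : R := (set_val (f x) : {ptws I -> R}) i.
exists (range e); split.
- move=> _ [i _ <-] x.
  have cval : continuous (@set_val {ptws I -> R} S).
    exact: initial_continuous.
  have cp : continuous (fun y : {ptws I -> R} => y i).
    exact: ptws_proj_continuous.
  exact: (continuous_comp (continuous_comp (cf x) (cval _)) (cp _)).
- move=> x; have := S_Sigma _ (set_valP (f x)).
  move=> /(image_countable e); apply: subset_countable => _ [[i _ <-] ex].
  by exists i.
- move=> x y _ _ exy; apply: (can_inj fK); apply: val_inj.
  by apply/funext => i; apply: (exy (e i)); exists i.
Qed.

(** The index set is the type of all functions; those outside [E] contribute
    the coordinate 0, which is harmless for countability of supports. *)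
Lemma sigma_family_corson E : sigma_family [set: K] E -> corson R K.
Proof.
move=> [cE supE sepE].
pose F (x : K) : {ptws (K -> R) -> R} := fun h => if `[< E h >] then h x else 0.
have cF : continuous F.
  apply: ptws_continuous => h; rewrite /F.
  by case: asboolP => [/cE //|_ x]; exact: cvg_cst.
exists (K -> R), (range F); split.
  move=> _ [x _ <-]; apply: subset_countable (supE x) => h /=.
  by rewrite /F; case: asboolP => //; rewrite eqxx.
have /choice[g gP] : forall s : range F, exists x, F x = set_val s.
  by move=> s; have [x _ xs] := set_valP s; exists x.
pose f x : range F := SigSub (mem_set (imageT F x)).
have FE x h : E h -> F x h = h x by move=> Eh; rewrite /F asboolT.
have fK x : g (f x) = x.
  by apply: sepE => // h Eh; rewrite -!FE // gP.
exists f, g; split => //.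
- by apply: continuous_comp_initial; exact: cF.
- apply: (@continuous_of_separating _ _ _ setT E) => //.
  + exact: Rhausdorff.
  + move=> h Eh; split; first exact: cE.
    have -> : h \o g = (fun y : {ptws (K -> R) -> R} => y h) \o set_val.
      by apply/funext => s; rewrite /= -FE // gP.
    move=> s; apply: continuous_comp; first exact: initial_continuous.
    exact: ptws_proj_continuous.
- by move=> s; apply: val_inj; exact: gP.
Qed.

End SigmaFamilies.

(** * From a Sigma family to retractions *)

Section Boxes.
Context {R : realType} {K : topologicalType}.
Hypotheses (K_compact : compact [set: K]).

Definition window := ((K -> R) * (rat * rat))%type.

Definition box (b : seq window) : set K :=
  [set x | all (fun w => ratr w.2.1 < w.1 x < ratr w.2.2) b].

(** The traces on [Z] of the boxes over [J] around [x] are a filter base, and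
    at its cluster points the members of [J] have the same values as at [x]. *)
Lemma box_cluster (J : set (K -> R)) (Z : set K) x :
  (forall h, J h -> continuous h) -> closed Z ->
  (forall b, [set` unzip1 b] `<=` J -> box b x -> (box b `&` Z) !=set0) ->
  exists2 z, Z z & forall h, J h -> h z = h x.
Proof.
move=> cJ clZ Zbox.
have [||||z zb] := @compact_directed_meet K _
    [set b : seq window | [set` unzip1 b] `<=` J /\ box b x]
    (fun b => closure (box b `&` Z)) K_compact.
- by exists [::].
- by move=> b _; exact: closed_closure.
- move=> b [bJ bx]; apply: subset_nonempty (Zbox b bJ bx).
  exact: subset_closure.
- move=> b c [bJ bx] [cJ' cx]; exists (b ++ c).
    split; last by rewrite /box /= all_cat; apply/andP.
    by move=> h; rewrite /= /unzip1 map_cat mem_cat => /orP[/bJ|/cJ'].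
  by rewrite subsetI; split; apply: closureS => y [];
     rewrite /box /= all_cat => /andP[].
exists z.
  rewrite (closure_id Z).1 //; have : closure (box [::] `&` Z) z by apply: zb.
  by apply: closureS => y [].
move=> h Jh.
have between p q : ratr p < h x -> h x < ratr q -> ratr p <= h z <= ratr q.
  move=> ph hq.
  have clI : closed (h @^-1` `[ratr p, ratr q]).
    apply: preimage_closed; last exact: itv_closed.
    by move=> y _; exact: cJ.
  have : closure (box [:: (h, (p, q))] `&` Z) z.
    apply: zb; split; first by move=> k /=; rewrite inE => /eqP ->.
    by rewrite /box /= ph hq.
  move=> /(closureS (B := h @^-1` `[ratr p, ratr q])) H.
  have /clI : closure (h @^-1` `[ratr p, ratr q]) z.
    apply: H => y [+ _]; rewrite /box /= andbT in_itv /= => /andP[].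
    by move=> /ltW -> /ltW ->.
  by rewrite /= in_itv.
have [|p0] := @rat_in_itvoo R (h x - 1) (h x); first by rewrite ltrBlDr ltrDl.
rewrite in_itv /= => /andP[_ p0x].
have [|q0] := @rat_in_itvoo R (h x) (h x + 1); first by rewrite ltrDl.
rewrite in_itv /= => /andP[xq0 _].
case: (ltgtP (h z) (h x)) => // [zx|xz].
- have [p] := rat_in_itvoo zx; rewrite in_itv /= => /andP[zp px].
  by have /andP[] := between p q0 px xq0; rewrite leNgt zp.
- have [q] := rat_in_itvoo xz; rewrite in_itv /= => /andP[xq qz].
  by have /andP[_] := between p0 q p0x xq; rewrite leNgt qz.
Qed.
End Boxes.

Section SigmaToRetractions.
Context {R : realType} {K : topologicalType}.
Hypotheses (K_compact : compact [set: K]) (K_hausdorff : hausdorff_space K).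

(** [Phi s] collects the supports of the points selected in the boxes over
    [s]; being closed under [Phi] is exactly what [box_cluster] requires in
    order to find the value of the retraction. *)
Lemma sigma_family_monotonically_retractable (E : set (K -> R)) :
  sigma_family [set: K] E -> monotonically_retractable K.
Proof.
move=> [cE supE sepE].
have [sel selP] := countable_selection K.
pose Phi (s : seq (K -> R)) : set (K -> R) :=
  \bigcup_(b in [set b : seq (@window R K) | unzip1 b = s])
    \bigcup_(x in sel (box b)) supp E x.
have cPhi s : countable (Phi s).
  apply: bigcup_countable => [|b _].
    have := image_countable (zip s) (countableP [set: seq (rat * rat)]).
    apply: subset_countable.
    by move=> b <-; exists (unzip2 b) => //; rewrite zip_unzip.
  by apply: bigcup_countable => [|x _]; [have [] := selP (box b)|exact: supE].
pose S (A : set K) := \bigcup_(x in A) supp E x.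
pose J A := hull Phi (S A).
have JE A : J A `<=` E.
  by apply: hull_min => [s _ h [b _ [x _ []]]|h [x _ []]].
have rE A x : exists y, forall h, E h -> h y = if `[< J A h >] then h x else 0.
  have [||b bJ bx|y Zy yJ] := @box_cluster R K K_compact (J A)
     (\bigcap_(h in E `\` J A) h @^-1` [set 0]) x.
  - by move=> h /JE/cE.
  - apply: closed_bigI => h [Eh _]; apply: preimage_closed.
      by move=> y _; exact: cE.
    exact/accessible_closed_set1/hausdorff_accessible/Rhausdorff.
  - have [_ selb []] := selP (box b); first by exists x.
    move=> y sy; exists y; split; first exact: selb.
    move=> h [Eh nJh]; apply: contrapT => /eqP hy; apply: nJh.
    by apply: (hull_closed bJ); exists b => //; exists y.
  - exists y => h Eh; case: asboolP => [/yJ //|nJ]; exact: Zy.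
have /choice[r' r'P] : forall Ax : set K * K, exists y, forall h, E h ->
    h y = if `[< J Ax.1 h >] then h Ax.2 else 0.
  by move=> [A x]; exact: rE.
pose r A x := r' (A, x).
have rP A x h : E h -> h (r A x) = if `[< J A h >] then h x else 0.
  exact: r'P (A, x) h.
pose N (A : set K) : set (set K) :=
  [set box b | b in [set b : seq (@window R K) | [set` unzip1 b] `<=` J A]].
exists r, N; split; first split.
- move=> A B _ _ AB; apply: image_subset => b bJ; apply: subset_trans bJ _.
  by apply: hull_mono => h [x /AB Bx xh]; exists x.
- move=> A _ mA.
  have JU : J (\bigcup_n A n) = \bigcup_n J (A n).
    rewrite /J -hull_bigcup; last first.
      by move=> m n mn h [x /(mA _ _ mn) Ax xh]; exists x.
    congr (hull _ _); rewrite /S; apply/seteqP; split=> h.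
      by move=> [x [n _ Ax] xh]; exists n => //; exists x.
    by move=> [n _ [x Ax xh]]; exists x => //; exists n.
  apply/seteqP; split=> P; last first.
    move=> [n _ [b bJ <-]]; exists b => //= h hb; rewrite JU.
    by exists n => //; exact: bJ.
  move=> [b /= + <-]; rewrite JU => /seq_sub_directed[||n _ bJ].
  + by exists 0%N.
  + move=> i j _ _; exists (maxn i j) => //.
    have JS m n : (m <= n)%N -> J (A m) `<=` J (A n).
      by move=> mn; apply: hull_mono => h [x /(mA _ _ mn) Ax xh]; exists x.
    by split; apply: JS; rewrite ?leq_maxl ?leq_maxr.
  + by exists n => //; exists b.
move=> A cA.
have cJA : countable (J A).
  apply: countable_hull => //; apply: bigcup_countable => // x _; exact: supE.
have cr : continuous (r A).
  apply: (@continuous_of_separating _ _ _ setT E) => //.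
  - exact: Rhausdorff.
  - move=> h Eh; split; first exact: cE.
    have -> : h \o r A = fun x => if `[< J A h >] then h x else 0.
      by apply/funext => x; rewrite /= rP.
    by case: asboolP => [_|_ y]; [exact: cE|exact: cvg_cst].
split.
- split=> // x; apply: sepE => // h Eh; rewrite /= !rP //; by case: asboolP.
- move=> x Ax; exists x => //; apply: sepE => // h Eh; rewrite rP //.
  case: asboolP => // nJ; apply: contrapT => /eqP; rewrite eq_sym => hx.
  by apply: nJ; apply: sub_hull; exists x.
- apply: image_countable.
  have := image_countable (fun st => zip st.1 st.2)
    (countableX (countable_seq_sub cJA) (countableP [set: seq (rat * rat)])).
  apply: subset_countable => b bJ; exists (unzip1 b, unzip2 b) => //=.
  exact: zip_unzip.
(* If no box over [J A] around [x] mapped into [U], the boxes would cluster at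
   a point which [r A] maps outside [U] although it agrees with [x] on [J A]. *)
move=> U oU; exists [set P | N A P /\ P `<=` r A @^-1` U].
  by move=> P [].
apply/seteqP; split=> [x Ux|x [P [_ PU] Px]]; last exact: PU.
apply: contrapT => nx.
have [|||z nUz zJ] := @box_cluster R K K_compact (J A) (~` (r A @^-1` U)) x.
- by move=> h /JE/cE.
- by apply: open_closedC; apply: open_comp => // y _; exact: cr.
- move=> b bJ bx; apply: contrapT => bU; apply: nx.
  exists (box b) => //; split; first by exists b.
  by move=> y yb; apply: contrapT => nUy; apply: bU; exists y.
apply: nUz; change (U (r A z)); suff -> : r A z = r A x by [].
by apply: sepE => // h Eh; rewrite !rP //; case: asboolP => // /zJ.
Qed.

End SigmaToRetractions.

(** * Retractions of the countable good sets *)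

Import numFieldNormedType.Exports.

Section FullSkeleton.
Context {K : topologicalType}.
Hypotheses (K_compact : compact [set: K]) (K_hausdorff : hausdorff_space K).
Variables (r : set K -> K -> K) (N : set K -> set (set K)).
Hypothesis N_omega : omega_monotone N.
Hypothesis rN : forall A : set K, countable A ->
  [/\ retraction (r A), A `<=` range (r A), countable (N A) &
      network_of_map (r A) (N A)].
Variable sel : set K -> set K.
Hypothesis selP : forall P : set K,
  [/\ countable (sel P), sel P `<=` P & P !=set0 -> sel P !=set0].

Lemma countable_seq (s : seq K) : countable [set` s].
Proof. exact/finite_set_countable/finite_seq. Qed.
Hint Resolve countable_seq : core.

(** A countable set is the union of an increasing sequence of finite sets, and
    [N] commutes with this union. *)
Lemma network_finitary (A P : set K) : countable A -> N A P ->
  exists2 s : seq K, [set` s] `<=` A & N [set` s] P.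
Proof.
move=> cA; have /countable_injP[u u_inj] := cA.
pose B n := A `&` [set x | (u x < n)%N].
have finB n : finite_set (B n).
  have injB : {in B n &, injective u}.
    by move=> x y /set_mem[Ax _] /set_mem[Ay _]; apply: u_inj; exact: mem_set.
  have := inj_card_eq injB; rewrite card_eq_le => /andP[_ /card_le_finite].
  apply; apply: sub_finite_set (finite_II n) => _ [x [_ xn] <-]; exact: xn.
have mB m n : (m <= n)%N -> B m `<=` B n.
  by move=> mn x [Ax xm]; split=> //; exact: leq_trans mn.
have cB n : countable (B n) by exact: finite_set_countable.
have AE : A = \bigcup_n B n.
  apply/seteqP; split=> [x Ax|x [n _ []] //]; exists (u x).+1 => //.
  by split => //=.
rewrite AE (N_omega.2 B cB mB) => -[n _].
have /finite_seqP[s sE] := finB n.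
by rewrite sE => NP; exists s => // x; rewrite -sE => Bx; exists n.
Qed.

Lemma network_mono (A B : set K) :
  countable B -> A `<=` B -> N A `<=` N B.
Proof. by move=> cB AB; apply: N_omega.1 => //; exact: subset_countable cB. Qed.

Lemma network_at A x U : countable A -> nbhs (r A x) U ->
  exists P, [/\ N A P, P x & forall y, P y -> U (r A y)].
Proof.
move=> cA; rewrite nbhsE => -[V [oV Vx] VU].
have [_ _ _ /(_ V oV)[G GN GV]] := rN cA.
have : (r A @^-1` V) x by [].
rewrite GV => -[P GP Px]; exists P; split=> //; first exact: GN.
move=> y Py; apply: VU.
by have : (\bigcup_(Q in G) Q) y by [exists P]; rewrite -GV.
Qed.

Lemma retraction_continuous A : countable A -> continuous (r A).
Proof. by move=> /rN[[]]. Qed.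

Lemma retraction_fix A x : countable A -> closure A x -> r A x = x.
Proof.
move=> cA Ax; apply/esym; apply: K_hausdorff => U V Ux Vx.
have [[cr idr] Ar _ _] := rN cA.
have [|y [Ay [Uy Vy]]] := Ax (U `&` r A @^-1` V).
  by apply: filterI => //; exact: cr.
exists y; split => //; have [z _ zy] := Ar y Ay.
have rr : r A (r A z) = r A z by exact: (congr1 (fun g => g z) (funext idr)).
by rewrite -zy -rr zy.
Qed.

(** The points to be added to a set so that two members of its network which
    meet also meet inside it. *)
Definition meeting (s : seq K) : set K :=
  \bigcup_(PQ in N [set` s] `*` N [set` s]) sel (PQ.1 `&` PQ.2).

Definition good A := closed_under meeting A.

Lemma countable_meeting s : countable (meeting s).
Proof.
apply: bigcup_countable => [|PQ _]; last by have [] := selP (PQ.1 `&` PQ.2).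
by apply: countableX; have [] := rN (countable_seq s).
Qed.

Lemma good_meets A P Q x : countable A -> good A -> N A P -> N A Q ->
  P x -> Q x -> exists2 a, A a & P a /\ Q a.
Proof.
move=> cA gA /(network_finitary cA)[s sA sP].
move=> /(network_finitary cA)[t tA tQ] Px Qx.
have [_ selPQ []] := selP (P `&` Q); first by exists x.
move=> a aPQ; exists a; last exact: selPQ.
apply: (gA (s ++ t)).
  by move=> y /=; rewrite mem_cat => /orP[/sA|/tA].
exists (P, Q) => //; split.
  by apply: network_mono sP => // y /= ys; rewrite mem_cat ys.
by apply: network_mono tQ => // y /= ys; rewrite mem_cat ys orbT.
Qed.

(** Close to [r A x], a point of [P] and of [A] is found in the intersection
    of [P] with a member of the network that [r A] maps close to [r A x];
    [r A] fixes the points of [A]. *)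
Lemma retraction_limit A P x : countable A -> good A -> N A P -> P x ->
  closure (P `&` A) (r A x).
Proof.
move=> cA gA NP Px U /(network_at cA)[Q [NQ Qx QU]].
have [a Aa [Pa Qa]] := good_meets cA gA NP NQ Px Qx.
exists a; split=> //; rewrite -(retraction_fix cA (subset_closure Aa)).
exact: QU.
Qed.

Lemma retraction_closure A x : countable A -> good A -> closure A (r A x).
Proof.
move=> cA gA; have [|P [NP Px _]] := @network_at A x setT cA.
  exact: filterT.
by apply: closureS (retraction_limit cA gA NP Px) => y [].
Qed.

(** A member of [N A] that contains [x] and is mapped by [r A] near [r A x]
    also belongs to [N B], so its trace on [B] accumulates at [r B x]. *)
Lemma retraction_comp A B x : countable A -> countable B -> good B ->
  A `<=` B -> r A (r B x) = r A x.
Proof.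
move=> cA cB gB AB; apply/esym; apply: K_hausdorff => U V.
move=> /(network_at cA)[P [NP Px PU]] Vx.
have [|y [[Py By] Vy]] := retraction_limit cB gB (network_mono cB AB NP) Px
    (B := r A @^-1` V).
  exact: retraction_continuous.
by exists (r A y); split=> //; exact: PU.
Qed.

(** Let [H] be countable, contain [x], and contain a point of [P `&` S] for
    every [P] in [N H] that meets [S].  Since [r H x = x], points of [S] near
    [x] are mapped near [x], and so is a whole [P] in [N H] around such a
    point; [r H] fixes the point of [H] chosen in [P `&` S]. *)
Lemma countable_tightness (S : set K) x : closure S x ->
  exists C, [/\ countable C, C `<=` S & closure C x].
Proof.
move=> Sx.
pose Psi (s : seq K) : set K := \bigcup_(P in N [set` s]) sel (P `&` S).
have cPsi s : countable (Psi s).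
  apply: bigcup_countable => [|P _]; last by have [] := selP (P `&` S).
  by have [] := rN (countable_seq s).
pose H := hull Psi [set x].
have cH : countable H by apply: countable_hull => //; exact: countable1.
exists (S `&` H); split; first exact: subset_countable cH.
  by move=> y [].
have rx : r H x = x.
  by apply: (retraction_fix cH); apply: subset_closure; apply: sub_hull.
move=> U xU.
have /Sx[a [Sa Ua]] : nbhs x (r H @^-1` (interior U)).
  apply: retraction_continuous => //; rewrite rx; exact: nbhs_interior.
have [P [NP Pa PU]] := network_at cH Ua.
have [_ selPS []] := selP (P `&` S); first by exists a.
move=> b bPS; have [Pb Sb] := selPS _ bPS.
have Hb : H b.
  have [s sH sP] := network_finitary cH NP.
  by apply: (hull_closed sH); exists P.
exists b; split => //; rewrite -(retraction_fix cH (subset_closure Hb)).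
exact: PU.
Qed.

(** * Retractions of all good sets *)

Lemma hull_good C : good (hull meeting C). Proof. exact: hull_closed. Qed.

Lemma countable_hull_meeting C : countable C -> countable (hull meeting C).
Proof. exact/countable_hull/countable_meeting. Qed.

(** The index set of a retractional skeleton of the closure of [A]. *)
Definition skeleton A : set (set K) :=
  [set B | [/\ countable B, good B & B `<=` A]].

Lemma skeleton_hull A C : good A -> countable C -> C `<=` A ->
  skeleton A (hull meeting C).
Proof.
move=> gA cC CA; split.
- exact: countable_hull_meeting.
- exact: hull_good.
- exact: hull_min.
Qed.

(** What the retraction onto the closure of [A] is to identify. *)
Definition indist A x y := forall B, skeleton A B -> r B x = r B y.

(** By tightness [x] and [y] lie in the closure of a single countable good
    subset of [A], whose retraction fixes them. *)
Lemma indist_closure A x y : good A -> closure A x -> closure A y ->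
  indist A x y -> x = y.
Proof.
move=> gA /countable_tightness[C [cC CA Cx]] /countable_tightness[D [cD DA Dy]].
have cCD : countable (C `|` D) by exact: countableU.
have CDA : C `|` D `<=` A by rewrite subUset.
move=> /(_ _ (skeleton_hull gA cCD CDA)).
have cH := countable_hull_meeting cCD.
rewrite !retraction_fix //.
- apply: closureS Dy; apply: subset_trans (@sub_hull _ _ _); exact: subsetUr.
- apply: closureS Cx; apply: subset_trans (@sub_hull _ _ _); exact: subsetUl.
Qed.

(** The point [r B x] satisfies the constraints coming from the good subsets
    of [B]; compactness provides a common solution. *)
Lemma indist_exists A x : good A -> exists2 y, closure A y & indist A x y.
Proof.
move=> gA.
have [||||y yF] := @compact_directed_meet K _ (skeleton A)
    (fun B => closure A `&` [set y | r B y = r B x]) K_compact.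
- by exists (hull meeting set0); exact: skeleton_hull.
- move=> B [cB _ _]; apply: closedI; first exact: closed_closure.
  apply: (@preimage_closed _ _ (r B) [set r B x]).
    by move=> y _; exact: retraction_continuous.
  exact/accessible_closed_set1/hausdorff_accessible.
- move=> B [cB gB BA]; exists (r B x); split.
    by apply: closureS BA _ _; exact: retraction_closure.
  exact/retraction_fix/retraction_closure.
- move=> B C [cB gB BA] [cC gC CA].
  have cU : countable (B `|` C) by exact: countableU.
  have sH : skeleton A (hull meeting (B `|` C)).
    by apply: skeleton_hull; rewrite // subUset.
  exists (hull meeting (B `|` C)) => //; have [cH gH HA] := sH.
  have BH : B `<=` hull meeting (B `|` C).
    by apply: subset_trans (@sub_hull _ _ _); exact: subsetUl.
  have CH : C `<=` hull meeting (B `|` C).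
    by apply: subset_trans (@sub_hull _ _ _); exact: subsetUr.
  move=> y [Ay /= yH]; split; split=> //=.
    by rewrite -(retraction_comp y cB cH gH BH) yH retraction_comp.
  by rewrite -(retraction_comp y cC cH gH CH) yH retraction_comp.
exists y => [|B sB]; last by have [_ ->] := yF B sB.
by have [] := yF _ (skeleton_hull gA (@countable0 K) (@sub0set _ _)).
Qed.

Lemma skeletonS A B : A `<=` B -> skeleton A `<=` skeleton B.
Proof. by move=> AB C [cC gC CA]; split=> //; exact: subset_trans AB. Qed.

Lemma nbhs_closure_sub (x : K) U : nbhs x U ->
  exists2 V, nbhs x V & closure V `<=` U.
Proof. exact: (@compact_regular K x setT K_hausdorff K_compact filterT). Qed.

(** If [r B x] and [r B y] differ, two members of [N B] testify to it.  They
    belong to the network of a finite subset of [B], hence of some [F i], and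
    testify to the same for the retraction of [B `&` F i]. *)
Lemma indist_cover (I : Type) (D : set I) (F : I -> set K) A x y :
  (forall s : seq K, [set` s] `<=` A -> exists2 i, D i & [set` s] `<=` F i) ->
  (forall i, D i -> good (F i)) ->
  (forall i, D i -> indist (F i) x y) -> indist A x y.
Proof.
move=> AF gF Fxy B [cB gB BA]; apply: K_hausdorff => U V Ux Vy.
have [U' xU' U'U] := nbhs_closure_sub Ux.
have [V' yV' V'V] := nbhs_closure_sub Vy.
have [P [NP Px PU]] := network_at cB xU'.
have [Q [NQ Qy QV]] := network_at cB yV'.
have [s sB sP] := network_finitary cB NP.
have [t tB tQ] := network_finitary cB NQ.
have stB : [set` s ++ t] `<=` B.
  by move=> z /=; rewrite mem_cat => /orP[/sB|/tB].
have [i Di stF] := AF _ (subset_trans stB BA).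
have cBF : countable (B `&` F i) by exact: subset_countable cB.
have gBF : good (B `&` F i) by apply: closed_underI => //; exact: gF.
have sBF : skeleton (F i) (B `&` F i) by split=> // z [].
have near_retraction M z W : N (B `&` F i) M -> M z ->
    (forall y, M y -> W (r B y)) -> closure W (r (B `&` F i) z).
  move=> NM Mz MW; apply: closureS (retraction_limit cBF gBF NM Mz).
  move=> b [/MW + [Bb _]]; rewrite retraction_fix //; exact: subset_closure.
have NP' : N (B `&` F i) P.
  apply: network_mono sP => // z zs; split; first exact: sB.
  by apply: stF; rewrite /= mem_cat [X in X || _]zs.
have NQ' : N (B `&` F i) Q.
  apply: network_mono tQ => // z zs; split; first exact: tB.
  by apply: stF; rewrite /= mem_cat [X in _ || X]zs orbT.
exists (r (B `&` F i) x); split; first exact/U'U/near_retraction/PU.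
by rewrite (Fxy i Di _ sBF); exact/V'V/near_retraction/QV.
Qed.

Lemma skeleton_retraction : exists rho : set K -> K -> K,
  forall A, good A -> forall x, closure A (rho A x) /\ indist A x (rho A x).
Proof.
have /choice[g gP] : forall Ax : set K * K, exists y,
    good Ax.1 -> closure Ax.1 y /\ indist Ax.1 Ax.2 y.
  move=> [A x]; have [gA|nA] := pselect (good A); last by exists x.
  by have [y Ay xy] := indist_exists x gA; exists y.
by exists (fun A x => g (A, x)) => A gA x; exact: gP (A, x) gA.
Qed.

Section ChainOfRetractions.
Context {R : realType}.
Variable rho : set K -> K -> K.
Hypothesis rhoP : forall A, good A ->
  forall x, closure A (rho A x) /\ indist A x (rho A x).

Lemma rho_closure A x : good A -> closure A (rho A x).
Proof. by move=> gA; have [] := rhoP gA x. Qed.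

Lemma rho_eq A x y : good A -> closure A y -> indist A x y -> rho A x = y.
Proof.
move=> gA Ay xy; have [Ax xx] := rhoP gA x.
by apply: (indist_closure gA) => // B AB; rewrite -(xy B AB) (xx B AB).
Qed.

Lemma rho_fix A x : good A -> closure A x -> rho A x = x.
Proof. by move=> gA Ax; exact: rho_eq. Qed.

Lemma rho_comp A B x : good A -> good B -> A `<=` B ->
  rho A (rho B x) = rho A x.
Proof.
move=> gA gB AB; apply/esym/rho_eq => //; first by have [] := rhoP gA (rho B x).
move=> C AC; have [_ xB] := rhoP gB x; have [_ xA] := rhoP gA (rho B x).
by rewrite (xB C (skeletonS AB AC)) (xA C AC).
Qed.

Lemma rho_continuous A : good A -> continuous (rho A).
Proof.
move=> gA.
apply: (@continuous_of_separating _ _ _ (closure A) (r @` skeleton A)) => //.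
- exact: closed_closure.
- by move=> x; have [] := rhoP gA x.
- move=> _ [B AB <-]; have [cB _ _] := AB; split.
    exact: retraction_continuous.
  have -> : r B \o rho A = r B; last exact: retraction_continuous.
  by apply/funext => x; have [_ xA] := rhoP gA x; rewrite /= -(xA B AB).
- move=> x y Ax Ay xy; apply: (indist_closure gA) => // B AB.
  by apply: xy; exists B.
Qed.

Lemma indist_rho A x y : good A -> rho A x = rho A y -> indist A x y.
Proof.
move=> gA xy B AB; have [_ xA] := rhoP gA x; have [_ yA] := rhoP gA y.
by rewrite (xA B AB) (yA B AB) xy.
Qed.

Lemma rho_indist A x y : good A -> indist A x y -> rho A x = rho A y.
Proof.
move=> gA xy; have [Ay yA] := rhoP gA y.
by apply: rho_eq => // B AB; rewrite (xy B AB) (yA B AB).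
Qed.

(** * Sigma families along chains of good sets *)

Definition has_sigma_family A :=
  exists E : set (K -> R), sigma_family (closure (hull meeting A)) E.

(** Countably many functions suffice: one for each pair of members of [N A]
    that can be separated by a continuous function. *)
Lemma countable_has_sigma_family A : countable A -> has_sigma_family A.
Proof.
move=> /countable_hull_meeting; rewrite /has_sigma_family.
have := @hull_good A; move: (hull meeting A) => {}A gA cA.
(* Since [r A] is the identity on the closure of [A], a member of [N A] mapped
   into a small set meets this closure in a small set. *)
pose urysohn (PQ : set K * set K) (h : K -> R) :=
  forall x, closure A x -> (PQ.1 x -> h x = 0%R) /\ (PQ.2 x -> h x = 1%R).
have /choice[h hP] : forall PQ, exists h : K -> R, continuous h /\
    ((exists2 k : K -> R, continuous k & urysohn PQ k) -> urysohn PQ h).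
  move=> PQ; have [[k ck kPQ]|nk] :=
      pselect (exists2 k : K -> R, continuous k & urysohn PQ k).
    by exists k.
  by exists (fun=> 0%R); split=> // x; exact: cvg_cst.
have cN : countable (N A) by have [] := rN cA.
exists (h @` (N A `*` N A)); split.
- by move=> _ [PQ _ <-]; have [] := hP PQ.
- move=> x; have := image_countable h (countableX cN cN).
  by apply: subset_countable => e [].
- move=> x y Ax Ay xy; apply: contrapT => xNy.
  have := K_hausdorff; rewrite open_hausdorff => /(_ x y).
  move=> /(_ (introN eqP xNy))[[U V]] /= [/set_mem Ux /set_mem Vy].
  move=> [oU oV /eqP UV].
  have [U' xU' U'U] := nbhs_closure_sub (open_nbhs_nbhs (conj oU Ux)).
  have [V' yV' V'V] := nbhs_closure_sub (open_nbhs_nbhs (conj oV Vy)).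
  have U'V'0 : closure U' `&` closure V' = set0.
    by rewrite -subset0 => z [/U'U zU /V'V zV]; rewrite -UV; split.
  have [k [ck _ k0 k1]] : exists k : K -> R, [/\ continuous k,
      range k `<=` `[0%R, 1%R], k @` closure U' `<=` [set 0%R] &
      k @` closure V' `<=` [set 1%R]].
    apply/uniform_separatorP; apply: normal_uniform_separator.
    - exact: compact_normal.
    - exact: closed_closure.
    - exact: closed_closure.
    - exact: U'V'0.
  have [P [NP Px PU]] : exists P, [/\ N A P, P x & forall z, P z -> U' (r A z)].
    by apply: network_at => //; rewrite retraction_fix.
  have [Q [NQ Qy QV]] : exists Q, [/\ N A Q, Q y & forall z, Q z -> V' (r A z)].
    by apply: network_at => //; rewrite retraction_fix.
  have [_ hPQ] := hP (P, Q).
  have {}hPQ : urysohn (P, Q) (h (P, Q)).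
    apply: hPQ; exists k => // z Az; split=> /= Hz.
      apply: k0; exists z => //; apply: subset_closure.
      by rewrite -(retraction_fix cA Az); exact: PU.
    apply: k1; exists z => //; apply: subset_closure.
    by rewrite -(retraction_fix cA Az); exact: QV.
  have := xy (h (P, Q)); rewrite (hPQ x Ax).1 // (hPQ y Ay).2 // => /(_ _)/esym.
  by move=> H; have /eqP := H (ex_intro2 _ _ (P, Q) (conj NP NQ) erefl);
     rewrite oner_eq0.
Qed.

Context (le : rel K).
Hypotheses (le_total : total le) (le_anti : antisymmetric le)
  (le_trans : transitive le).
Hypothesis le_ind : forall Q : K -> Prop,
  (forall b, (forall c, le c b -> c != b -> Q c) -> Q b) -> forall b, Q b.
Variable f : K -> K.

Definition stage (S : set K) := hull meeting (f @` S).

Lemma stage_good S : good (stage S). Proof. exact: hull_good. Qed.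
Hint Resolve stage_good : core.

Lemma stage_closure S x : closure (stage S) (rho (stage S) x).
Proof. exact: (@rho_closure (stage S) x (@stage_good S)). Qed.

Lemma stageS S T : S `<=` T -> stage S `<=` stage T.
Proof. by move=> ST; apply: hull_mono; exact: image_subset. Qed.

Definition jumps x (S : set K) : set K :=
  S `&` [set b | rho (stage (upto le b)) x <> rho (stage (below le b)) x].

Lemma stage_countable_support S x : closure (stage S) x ->
  exists C, [/\ countable C, C `<=` S & closure (stage C) x].
Proof.
move=> /countable_tightness[C [cC CS Cx]].
have [D [cD DS CD]] := countable_sub_hull cC CS.
have /choice[g gP] : forall y, exists z, D y -> S z /\ f z = y.
  move=> y; have [/DS[z Sz zy]|nD] := pselect (D y); last by exists y.
  by exists z.
exists (g @` D); split; first exact: image_countable.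
  by move=> _ [y Dy <-]; have [] := gP y Dy.
apply: closureS Cx; apply: subset_trans CD _; apply: hull_mono => y Dy.
by exists (g y); [exists y|have [] := gP y Dy].
Qed.

(** The projection of [x] to the stage [S] is supported by a countable subset
    [C] of [S].  If [C] is bounded by some [b] in [S], the point [x] does not
    move from [b] on; otherwise [S] is the union of the countably many
    segments below the elements of [C]. *)
Lemma countable_jumps_step x S : initial le S ->
  (forall b, S b -> countable (jumps x (below le b))) -> countable (jumps x S).
Proof.
move=> iS IH.
have [C [cC CS Cx]] := stage_countable_support (@stage_closure S x).
have [[b Sb Cb]|unb] := pselect (exists2 b, S b & C `<=` below le b).
  apply: subset_countable (IH b Sb) => c [Sc jc]; split=> //.
  apply: contrapT => nbc; apply: jc.
  have bc : le b c.
    have /orP[//|cb] := le_total b c.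
    have [->|cNb] := eqVneq c b; first exact: total_refl.
    by case: nbc.
  have bS : below le b `<=` below le c.
    move=> d [db dNb]; split; first exact: le_trans bc.
    apply: contra_neq dNb => dE; apply: le_anti; rewrite db /=.
    by rewrite dE.
  have fixS T : below le c `<=` T -> T `<=` S ->
      rho (stage T) x = rho (stage S) x.
    move=> cT TS; rewrite -(rho_comp x (@stage_good T) (@stage_good S)).
      apply: rho_fix => //; apply: closureS Cx; apply: stageS.
      by apply: subset_trans Cb _; apply: subset_trans cT.
    exact: stageS.
  rewrite !fixS //.
  - by move=> d [dc _]; exact: iS dc.
  - by move=> d [].
  - by move=> d dc; exact: iS dc.
have := bigcup_countable (D := C)
  (F := fun c => jumps x (below le c) `|` [set c]) cC.
move=> H; apply: subset_countable (H _).
  move=> b [Sb jb].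
  have [c Cc bc] : exists2 c, C c & le b c.
    apply: contrapT => nc; apply: unb; exists b => // c Cc.
    have /orP[bc|cb] := le_total b c; first by case: nc; exists c.
    split => //; apply/eqP => cE; apply: nc; exists c => //.
    by rewrite cE; exact: total_refl.
  exists c => //; have [->|bNc] := eqVneq b c; first by right.
  by left; split.
by move=> c Cc; apply: countableU; [exact/IH/CS|exact: countable1].
Qed.

Lemma countable_jumps x S : initial le S -> countable (jumps x S).
Proof.
move=> iS; apply: countable_jumps_step => // b _; move: b.
apply: le_ind => b IH; apply: countable_jumps_step.
  exact: initial_below.
by move=> c [cb cNb]; exact: IH.
Qed.

(** The case of [set0] is not void: the empty set may generate points. *)
Lemma stage_seq_cover S (s : seq K) : initial le S -> [set` s] `<=` stage S ->
  [set` s] `<=` stage set0 \/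
  exists2 b, S b & [set` s] `<=` stage (upto le b).
Proof.
move=> iS /hull_seq_finitary[t tS st].
case: t tS st => [|y t] tS st.
  by left; apply: subset_trans st _; apply: hull_mono => z.
right.
have [|||b Sb tb] := @seq_sub_directed _ _ S (fun b => f @` upto le b) (y :: t).
- by have [|b Sb _] := tS y; [rewrite /= mem_head|exists b].
- move=> b c Sb Sc; have /orP[bc|cb] := le_total b c.
    exists c => //; split; last by [].
    by apply: image_subset => d db; exact: le_trans bc.
  exists b => //; split; first by [].
  by apply: image_subset => d dc; exact: le_trans cb.
- move=> z /tS[b Sb bz]; exists b => //; exists b => //; exact: total_refl.
by exists b => //; apply: subset_trans st _; exact: hull_mono.
Qed.

Lemma rho_stage_eq S x y : initial le S ->
  rho (stage set0) x = rho (stage set0) y ->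
  (forall b, S b -> rho (stage (upto le b)) x = rho (stage (upto le b)) y) ->
  rho (stage S) x = rho (stage S) y.
Proof.
move=> iS xy0 xyS; apply: rho_indist => //.
apply: (@indist_cover (set K) ([set set0] `|` [set upto le b | b in S]) stage).
- move=> s /(stage_seq_cover iS)[s0|[b Sb sb]].
    by exists set0 => //; left.
  by exists (upto le b) => //; right; exists b.
- by move=> T _.
- by move=> T [->|[b Sb <-]]; apply: indist_rho => //; exact: xyS.
Qed.

(** The functions [base e] account for the points generated by the empty set,
    which belong to every stage. *)
Lemma chain_has_sigma_family S : initial le S ->
  (forall b, S b -> has_sigma_family (f @` upto le b)) ->
  has_sigma_family (f @` S).
Proof.
move=> iS HS.
have [E0 [cE0 supE0 sepE0]] : has_sigma_family (f @` set0).
  by apply: countable_has_sigma_family; rewrite image_set0.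
have /choice[E EP] : forall b, exists E : set (K -> R), S b ->
    sigma_family (closure (stage (upto le b))) E.
  move=> b; have [/HS[E EP]|nS] := pselect (S b); first by exists E.
  by exists set0.
pose diff b (e : K -> R) x :=
  (e (rho (stage (upto le b)) x) - e (rho (stage (below le b)) x))%R.
pose base (e : K -> R) x := e (rho (stage set0) x).
exists ((\bigcup_(b in S) diff b @` E b) `|` base @` E0); split.
- move=> _ [[b Sb [e Ee <-]]|[e Ee <-]] x.
    have [cE _ _] := EP b Sb.
    apply: (@continuousB R R K (e \o rho (stage (upto le b)))
                              (e \o rho (stage (below le b)))).
      by apply: continuous_comp; [exact: rho_continuous|exact: cE].
    by apply: continuous_comp; [exact: rho_continuous|exact: cE].
  by apply: continuous_comp; [exact: rho_continuous|exact: cE0].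
- move=> x.
  pose G b := supp (E b) (rho (stage (upto le b)) x) `|`
              supp (E b) (rho (stage (below le b)) x).
  have cG b : S b -> countable (G b).
    by move=> /EP[_ supE _]; exact: countableU.
  pose H := (\bigcup_(b in jumps x S) diff b @` G b) `|`
            base @` supp E0 (rho (stage set0) x).
  have : countable H.
    apply: countableU; last exact: image_countable.
    apply: bigcup_countable => [|b [Sb _]]; first exact: countable_jumps.
    exact/image_countable/cG.
  apply: subset_countable => _ [[[b Sb [e Ee <-]]|[e Ee <-]] /= ex0].
  2: by right; exists e.
  left; exists b.
    by split=> // E1; move: ex0; rewrite /diff E1 subrr eqxx.
  exists e => //; have [e0|eN0] := eqVneq (e (rho (stage (upto le b)) x)) 0%R.
    right; split=> //; apply: contra_neq ex0.
    by rewrite /diff e0 => ->; rewrite subrr.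
  by left.
- move=> x y Sx Sy xy.
  rewrite -(rho_fix (@stage_good S) Sx) -(rho_fix (@stage_good S) Sy).
  have xy0 : rho (stage set0) x = rho (stage set0) y.
    apply: sepE0; [exact: stage_closure|exact: stage_closure|].
    by move=> e Ee; apply: (xy (base e)); right; exists e.
  apply: rho_stage_eq => //.
  (* Before the first stage that separates [x] from [y], the second term of
     [diff b e] takes the same value at both points. *)
  apply: le_ind => b IH Sb; have [_ _ sepE] := EP b Sb.
  apply: sepE; [exact: stage_closure|exact: stage_closure|].
  move=> e Ee; have : diff b e x = diff b e y.
    by apply: xy; left; exists b => //; exists e.
  rewrite /diff (@rho_stage_eq (below le b) x y) //; last 2 first.
  - exact: initial_below.
  - by move=> c [cb cNb]; apply: IH => //; exact: iS cb.
  exact: addIr.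
Qed.

End ChainOfRetractions.

End FullSkeleton.

Lemma monotonically_retractable_sigma_family (K : topologicalType) :
  compact [set: K] -> hausdorff_space K -> forall R : realType,
  monotonically_retractable K ->
  exists E : set (K -> R), sigma_family [set: K] E.
Proof.
move=> cK hK R [r [N [Nomega rN]]].
have [sel selP] := countable_selection K.
have [rho rhoP] := skeleton_retraction cK hK Nomega rN selP.
have [le [le_total le_anti le_trans le_ind]] := exists_well_order K.
have : has_sigma_family (R := R) N sel [set: K].
  apply: (wo_chain_induction le_total le_anti le_trans le_ind).
    exact: (countable_has_sigma_family cK hK rN selP).
  move=> D f; exact: (chain_has_sigma_family cK hK Nomega rN selP rhoP le_total
    le_anti le_trans le_ind).
move=> [E EP]; exists E.
have -> // : [set: K] = closure (hull (meeting N sel) [set: K]).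
apply/seteqP; split=> // x _; apply: subset_closure; exact: sub_hull.
Qed.

Theorem corollary1p2 (R : realType) (K : topologicalType)
    (K_compact : compact [set: K]) (K_hausdorff : hausdorff_space K) :
  monotonically_retractable K <-> corson R K.
Proof.
split.
  move=> /(monotonically_retractable_sigma_family K_compact K_hausdorff R)[E].
  exact: sigma_family_corson.
move=> /corson_sigma_family[E].
exact: sigma_family_monotonically_retractable.
Qed.
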